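(* For real $q>-1$ and $x>0$ let $$V_q(x)=\frac{2e^{x^2}}{\Gamma(q+1)}\int_x^{\infty}e^{-t^2}(t^2-x^2)^q\,dt,$$ and let $V_q'$ denote the derivative of $V_q$ with respect to $x$. The following assertions are true: (a) for every $q>-1$ the function $x\mapsto xV_q'(x)/V_q(x)$ is strictly decreasing on $(0,\infty)$; (b) for every $q>-1$ the function $x\mapsto x^2V_q'(x)$ is strictly decreasing on $(0,\infty)$; (c) for every $q\geq 0$ the function $x\mapsto x^{-1}V_q'(x)$ is strictly increasing on $(0,\infty)$; (d) for every $q\geq 0$ the function $x\mapsto V_q'(x)/(xV_q(x))$ is strictly increasing on $(0,\infty)$.
   Context: $\Gamma$ denotes the Euler gamma function. The parameter $q$ is real. *)

(* Defs.v *)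
From HB Require Import structures.
From mathcomp Require Import all_boot all_order all_algebra.
From mathcomp Require Import all_classical all_reals all_analysis.

Set Implicit Arguments.
Unset Strict Implicit.
Unset Printing Implicit Defensive.

Import Order.TTheory GRing.Theory Num.Theory.
Import numFieldNormedType.Exports.

Local Open Scope classical_set_scope.
Local Open Scope ring_scope.

(* Euler's integral of the second kind, as a Lebesgue integral; meaningful for
   s > 0 only (the integral diverges for s <= 0, and Rintegral is then 0). *)
Definition Gamma (R : realType) (s : R) : R :=
  \int[@lebesgue_measure R]_(t in `]0, +oo[) (t `^ (s - 1) * expR (- t)).

(* The integration interval is open at x: for q < 0 the integrand is singular
   there, while on ]x, +oo[ with x >= 0 the base t ^+ 2 - x ^+ 2 is positive,
   where powR is the usual real power. *)
Definition Vq (R : realType) (q x : R) : R :=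
  2 * expR (x ^+ 2) / Gamma (q + 1) *
  \int[@lebesgue_measure R]_(t in `]x, +oo[)
    (expR (- t ^+ 2) * (t ^+ 2 - x ^+ 2) `^ q).

Definition strictly_increasing_pos (R : realType) (f : R -> R) : Prop :=
  {in `]0, +oo[%R &, {homo f : x y / x < y >-> x < y}}.

Definition strictly_decreasing_pos (R : realType) (f : R -> R) : Prop :=
  {in `]0, +oo[%R &, {homo f : x y / x < y >-> y < x}}.

(* Main.v *)
Require Import Defs.
From HB Require Import structures.
From mathcomp Require Import all_boot all_order all_algebra.
From mathcomp Require Import all_classical all_reals all_analysis.
From mathcomp Require Import measurable_realfun ring lra.
Import Order.TTheory GRing.Theory Num.Theory.
Import numFieldNormedType.Exports.
Local Open Scope classical_set_scope.
Local Open Scope ring_scope.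
Set Implicit Arguments.
Unset Strict Implicit.
Unset Printing Implicit Defensive.

(** Substituting [s = t ^+ 2 - x ^+ 2] and writing [y = x ^+ 2], the function
    becomes [V_q(x) = I_{1/2}(y) / Gamma(q + 1)], where
    [I_p(y)] is the integral over [s > 0] of [e^{-s} s^q (y + s)^{-p}].
    Differentiating under the integral sign gives [I_p' = - p I_{p+1}], hence
    [V_q'(x) = - x I_{3/2}(y) / Gamma(q + 1)].  As [y] increases with [x], the
    four assertions say that
    - [y I_{3/2}(y) / I_{1/2}(y)] increases (a),
    - [y^{3/2} I_{3/2}(y)] increases (b),
    - [I_{3/2}(y)] decreases (c),
    - [I_{3/2}(y) / I_{1/2}(y)] decreases (d).

    For (b) and (c) the integrands [(y / (y + s))^{3/2}] and [(y + s)^{-3/2}],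
    weighted by [e^{-s} s^q], are already monotone in [y] for each [s].

    The quotients in (a) and (d) are means of a positive function [k] for a
    measure that moves with [y], and in both cases the density of one measure
    with respect to the other is an increasing function [H] of [k] itself.  So
    both follow from one strict Chebyshev inequality, [integral_chebyshev]:
    passing from [f ds] to [H(k) f ds] increases the mean of [k].
    - In (d), [I_{p+1} / I_p] is the mean of [1 / (y + s)].  Lowering [y]
      multiplies the density by an increasing function of [k = 1 / (y1 + s)],
      and also increases the averaged function pointwise.
    - In (a) the two effects compete.  The scaling [s = y u] removes the
      dependence of the averaged function on [y]: the quotient is the mean of
      [k = 1 / (1 + u)] for the density [u^q (1 + u)^{-p} e^{- y u}], and
      raising [y] multiplies this density by [e^{- (y2 - y1) u}], again an
      increasing function of [k].

    For [-1 < q < 0] the integrands are singular at an end point, which is why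
    the change of variables ([Rsubstitution_oy]) is between open half-lines.
    All integrals converge because [e^{-s} s^q] is integrable
    ([integrable_gamma_weight]). *)

(** * Change of variables between open half-lines *)

Section substitution.
Context {R : realType}.
Notation mu := (@lebesgue_measure R).

Lemma is_derive_continuous (F : R -> R) (t l : R) :
  is_derive t 1 F l -> {for t, continuous F}.
Proof.
by move=> [dF _]; exact/differentiable_continuous/derivable1_diffP.
Qed.

Lemma pos_derive_lt (F f : R -> R) (a x y : R) :
  (forall t, a < t -> is_derive t 1 F (f t)) ->
  (forall t, a < t -> 0 < f t) -> a < x -> x < y -> F x < F y.
Proof.
move=> dF f0 ax xy.
have [||z] := @MVT R F f x y xy.
- by move=> t /[!in_itv]/= /andP[xt _]; apply: dF; exact: lt_trans xt.
- apply: derivable_within_continuous => u.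
  by rewrite in_itv/= => /andP[xu _]; have [] := dF u (lt_le_trans ax xu).
rewrite in_itv/= => /andP[xz _] FE.
by rewrite -subr_gt0 FE mulr_gt0 ?subr_gt0// f0// (lt_trans ax).
Qed.

Lemma substitution_segment (F f G : R -> R) (x y : R) : x < y ->
  {in `[x, y] &, {homo F : u v / u < v}} ->
  (forall t, x <= t -> is_derive t 1 F (f t)) ->
  {in `[x, y], continuous f} ->
  {within `[F x, F y], continuous G} ->
  (\int[mu]_(s in `[F x, F y]) (G s)%:E =
   \int[mu]_(t in `[x, y]) (G (F t) * f t)%:E)%E.
Proof.
move=> xy incF dF cf cG.
have dFE t : x <= t -> derive1 F t = f t.
  by move=> xt; rewrite derive1E; have [_ ->] := dF t xt.
have cF t : x <= t -> F z @[z --> t] --> F t.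
  by move=> xt; exact: is_derive_continuous (dF t xt).
have cfx : f z @[z --> x] --> f x by apply: cf; rewrite in_itv/= lexx ltW.
have cfy : f z @[z --> y] --> f y by apply: cf; rewrite in_itv/= lexx ltW.
rewrite (@integration_by_substitution_increasing R F G x y)//.
- apply: eq_integral => t; rewrite inE/= in_itv/= => /andP[xt _].
  by rewrite !fctE dFE.
- exact: ltW.
- move=> t; rewrite in_itv/= => /andP[xt ty].
  rewrite /continuous_at dFE ?ltW//.
  have : f z @[z --> t] --> f t by apply: cf; rewrite in_itv/= !ltW.
  apply: cvg_trans; apply: near_eq_cvg; near=> u; apply/esym/dFE/ltW.
  by near: u; exact: lt_nbhsr.
- apply/cvg_ex; exists (f x).
  apply: cvg_trans (cvg_at_right_filter cfx).
  by apply: near_eq_cvg; near=> u; apply/esym/dFE.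
- apply/cvg_ex; exists (f y).
  apply: cvg_trans (cvg_at_left_filter cfy).
  by apply: near_eq_cvg; near=> u; apply/esym/dFE; near: u; exact: nbhs_left_ge.
- split.
  + by move=> t; rewrite in_itv/= => /andP[xt _]; have [] := dF t (ltW xt).
  + by apply: cvg_at_right_filter; exact: cF.
  + by apply: cvg_at_left_filter; apply: cF; exact: ltW.
Unshelve. all: end_near. Qed.

(** The segments [[a + 1/(n+1), a + n + 2]] exhaust the half-line and their
    images under the increasing bijection [F] exhaust the other one; staying
    away from the end points allows [f] and [G] to be unbounded there. *)
Lemma substitution_oy (F f G : R -> R) (a b : R) :
  (forall t, a < t -> is_derive t 1 F (f t)) ->
  (forall t, a < t -> 0 < f t) ->
  (forall t, a < t -> {for t, continuous f}) ->
  (forall t, a < t -> b < F t) ->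
  (forall s, b < s -> exists2 t, a < t & F t = s) ->
  (forall s, b < s -> {for s, continuous G}) ->
  (forall s, b < s -> 0 <= G s) ->
  (\int[mu]_(s in `]b, +oo[) (G s)%:E =
   \int[mu]_(t in `]a, +oo[) (G (F t) * f t)%:E)%E.
Proof.
move=> dF f0 cf bF surj cG G0.
have incF x y : a < x -> x < y -> F x < F y by exact: pos_derive_lt.
have cF t : a < t -> {for t, continuous F}.
  by move=> at_; apply: is_derive_continuous (dF t at_).
pose l n : R := a + n.+1%:R^-1.
pose r n : R := a + n.+1%:R + 1.
have al n : a < l n by rewrite /l ltrDl invr_gt0.
have lr n : l n < r n.
  rewrite /l /r -addrA ltrD2l (@le_lt_trans _ _ 1)//.
    by rewrite invf_le1// ler1n.
  by rewrite ltrDr.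
have ltl m n : (m <= n)%N -> l n <= l m.
  by move=> mn; rewrite /l lerD2l lef_pV2 ?posrE// ler_nat ltnS.
have ltr m n : (m <= n)%N -> r m <= r n.
  by move=> mn; rewrite /r lerD2r lerD2l ler_nat ltnS.
have exh t : a < t -> exists n, l n < t < r n.
  move=> at_; near \oo => n; exists n; apply/andP; split.
    rewrite /l -ltrBrDl; near: n.
    have ta0 : 0 < t - a by rewrite subr_gt0.
    exact: (near_infty_natSinv_lt (PosNum ta0)).
  rewrite /r -addrA -ltrBlDl (@lt_trans _ _ n.+1%:R)//; last by rewrite ltrDl.
  rewrite -natr1 ltr_wpDr//.
  by near: n; exact: nbhs_infty_gtr.
have UI : \bigcup_n `[l n, r n]%classic = `]a, +oo[%classic.
  apply/seteqP; split=> [t [n _]|t]; rewrite /= !in_itv/= andbT.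
    by move=> /andP[+ _]; exact: lt_le_trans.
  move=> /exh[n /andP[lt tr]]; exists n => //=.
  by rewrite in_itv/= !ltW.
have UJ : \bigcup_n `[F (l n), F (r n)]%classic = `]b, +oo[%classic.
  apply/seteqP; split=> [t [n _]|t]; rewrite /= !in_itv/= andbT.
    by move=> /andP[+ _]; apply: lt_le_trans; exact: bF.
  move=> /surj[u au <-]; have [n /andP[lu ur]] := exh u au; exists n => //=.
  by rewrite in_itv/= !ltW// incF.
have leF x y : a < x -> x <= y -> F x <= F y.
  by move=> ax; rewrite le_eqVlt => /predU1P[->//|xy]; exact/ltW/incF.
have eqn n : (\int[mu]_(s in `[F (l n), F (r n)]) (G s)%:E =
    \int[mu]_(t in `[l n, r n]) (G (F t) * f t)%:E)%E.
  apply: substitution_segment => //.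
  - move=> u v; rewrite !in_itv/= => /andP[lu _] _; apply: incF.
    exact: lt_le_trans lu.
  - by move=> t lt; apply: dF; exact: lt_le_trans lt.
  - move=> t; rewrite in_itv/= => /andP[lt _]; apply: cf.
    exact: lt_le_trans lt.
  - apply: continuous_in_subspaceT => s; rewrite inE/= in_itv/= => /andP[ls _].
    by apply: cG; apply: lt_le_trans ls; exact: bF.
have cGF t : a < t -> {for t, continuous (fun t => G (F t) * f t)}.
  move=> at_; apply: continuousM; last exact: cf.
  by apply: continuous_comp; [exact: cF|exact/cG/bF].
rewrite -UI -UJ.
apply: (@cvg_unique _ _ (\int[mu]_(s in `[F (l n), F (r n)]) (G s)%:E @[n --> \oo])%E) => //.
  apply: ge0_nondecreasing_set_cvg_integral => //.
  - move=> m n mn; rewrite subsetEset => s /=; rewrite !in_itv/=.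
    move=> /andP[ms sm]; apply/andP; split.
      by apply: le_trans ms; apply: leF => //; exact: ltl.
    apply: (le_trans sm); apply: leF; last exact: ltr.
    exact: lt_trans (lr m).
  - move=> n; apply/measurable_EFinP.
    apply: subspace_continuous_measurable_fun => //.
    apply: continuous_in_subspaceT => s; rewrite inE/= in_itv/= => /andP[ls _].
    by apply: cG; apply: lt_le_trans ls; exact: bF.
  - move=> n s /=; rewrite in_itv/= => /andP[ls _]; rewrite lee_fin G0//.
    by apply: lt_le_trans ls; exact: bF.
rewrite (funext eqn).
apply: ge0_nondecreasing_set_cvg_integral => //.
- move=> m n mn; rewrite subsetEset => s /=; rewrite !in_itv/=.
  move=> /andP[ms sm]; apply/andP; split; first exact: le_trans (ltl _ _ mn) ms.
  exact: le_trans sm (ltr _ _ mn).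
- move=> n; apply/measurable_EFinP.
  apply: subspace_continuous_measurable_fun => //.
  apply: continuous_in_subspaceT => s; rewrite inE/= in_itv/= => /andP[ls _].
  by apply: cGF; exact: lt_le_trans ls.
- move=> n s /=; rewrite in_itv/= => /andP[ls _].
  have as_ : a < s by exact: lt_le_trans ls.
  by rewrite lee_fin mulr_ge0// ?G0 ?bF// ltW// f0.
Unshelve. all: end_near. Qed.

(** The real-valued form, which also transports integrability. *)
Lemma Rsubstitution_oy (F f G : R -> R) (a b : R) :
  (forall t, a < t -> is_derive t 1 F (f t)) ->
  (forall t, a < t -> 0 < f t) ->
  (forall t, a < t -> {for t, continuous f}) ->
  (forall t, a < t -> b < F t) ->
  (forall s, b < s -> exists2 t, a < t & F t = s) ->
  (forall s, b < s -> {for s, continuous G}) ->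
  (forall s, b < s -> 0 <= G s) ->
  mu.-integrable `]b, +oo[ (EFin \o G) ->
  mu.-integrable `]a, +oo[ (EFin \o (fun t => G (F t) * f t)) /\
  \int[mu]_(s in `]b, +oo[) G s = \int[mu]_(t in `]a, +oo[) (G (F t) * f t).
Proof.
move=> dF f0 cf bF surj cG G0 iG.
have sub := substitution_oy dF f0 cf bF surj cG G0.
have a0 t : t \in `]a, +oo[%classic -> a < t by rewrite inE/= in_itv/= andbT.
split; last by rewrite /Rintegral sub.
apply/integrableP; split.
  apply/measurable_EFinP; apply: open_continuous_measurable_fun => //.
  move=> t /a0 at_; apply: continuousM; last exact: cf.
  apply: continuous_comp; first exact: is_derive_continuous (dF t at_).
  exact/cG/bF.
rewrite (_ : (\int[mu]_(t in _) _)%E = (\int[mu]_(s in `]b, +oo[) (G s)%:E)%E).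
  by apply: integrable_lty => //; exact: measurable_itv.
rewrite sub; apply: eq_integral => t /a0 at_.
by rewrite /= ger0_norm// mulr_ge0 ?G0 ?bF// ltW// f0.
Qed.

End substitution.

(** * Strict inequalities between integrals *)

Section positivity.
Context {R : realType}.
Notation mu := (@lebesgue_measure R).
Notation D := (`]0%R, +oo[%classic : set R).

Lemma integrable_oyZ (c : R) (g : R -> R) :
  mu.-integrable D (EFin \o g) ->
  mu.-integrable D (EFin \o (fun s => c * g s)).
Proof. exact: integrableZl. Qed.

Lemma integrable_oyB (g h : R -> R) :
  mu.-integrable D (EFin \o g) -> mu.-integrable D (EFin \o h) ->
  mu.-integrable D (EFin \o (fun s => g s - h s)).
Proof. exact: integrableB. Qed.

(** The exceptional point [s0] is there for Chebyshev's inequality below, whose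
    integrand vanishes where [k] takes its mean value. *)
Lemma Rintegral_gt0 (phi : R -> R) (s0 : R) :
  mu.-integrable D (EFin \o phi) ->
  (forall s, 0 < s -> 0 <= phi s) ->
  (forall s, 0 < s -> s != s0 -> 0 < phi s) ->
  0 < \int[mu]_(s in D) phi s.
Proof.
move=> iphi phi0 phi_gt0.
have D0 s : D s -> 0 < s by rewrite /= in_itv/= andbT.
rewrite lt_neqAle Rintegral_ge0 ?andbT; last by move=> s /D0; exact: phi0.
apply/eqP => /esym int0.
have eint0 : (\int[mu]_(s in D) `|(EFin \o phi) s| = 0)%E.
  transitivity (\int[mu]_(s in D) phi s)%:E; last by rewrite int0.
  rewrite /Rintegral fineK; last exact: integrable_fin_num.
  apply: eq_integral => s; rewrite inE => /D0 s0'.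
  by rewrite gee0_abs//= lee_fin phi0.
have mphi := measurable_int _ iphi.
have [A [mA A0 DA]] := (ae_eq_integral_abs mu (measurable_itv _) mphi).1 eint0.
have DU : D `<=` A `|` [set s0].
  move=> s Ds; have [->|ss0] := eqVneq s s0; first by right.
  left; apply: DA => /= /(_ Ds) [] /eqP.
  by rewrite gt_eqF// phi_gt0// D0.
have muD : (mu D <= mu (A `|` [set s0]))%E.
  by apply: le_measure; rewrite ?inE//; exact: measurableU.
have := le_trans muD (measureU2 mu mA (measurable_set1 s0)).
rewrite [X in (_ <= X + _)%E -> _]A0 [X in (_ <= _ + X)%E -> _]lebesgue_measure_set1 adde0.
by rewrite [X in (X <= _)%E -> _]lebesgue_measure_itv/= ltry leNgt ltry.
Qed.

Lemma Rintegral_lt (f g : R -> R) :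
  mu.-integrable D (EFin \o f) -> mu.-integrable D (EFin \o g) ->
  (forall s, 0 < s -> f s < g s) ->
  \int[mu]_(s in D) f s < \int[mu]_(s in D) g s.
Proof.
move=> fi gi fg; rewrite -subr_gt0 -RintegralB//.
apply: (@Rintegral_gt0 _ 0).
- exact: integrable_oyB.
- by move=> s s0; rewrite subr_ge0 ltW// fg.
- by move=> s s0 _; rewrite subr_gt0 fg.
Qed.

(** With [m] the mean of [k] for the measure [f ds], the function
    [(k - m) (H(k) - H(m)) f] is positive except where [k = m].  Its integral
    is [int k H(k) f - m int H(k) f], because the terms carrying the constant
    factor [H(m)] cancel by the choice of [m].  Since [H(m)] is available as
    the constant to subtract, no double integral is needed. *)
Lemma integral_chebyshev (f k H : R -> R) :
  (forall s, 0 < s -> 0 < f s) -> (forall s, 0 < s -> 0 < k s) ->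
  (forall s t, 0 < s -> 0 < t -> k s = k t -> s = t) ->
  (forall x y, 0 < x -> x < y -> H x < H y) ->
  mu.-integrable D (EFin \o f) ->
  mu.-integrable D (EFin \o (fun s => k s * f s)) ->
  mu.-integrable D (EFin \o (fun s => H (k s) * f s)) ->
  mu.-integrable D (EFin \o (fun s => k s * (H (k s) * f s))) ->
  (\int[mu]_(s in D) (k s * f s)) * (\int[mu]_(s in D) (H (k s) * f s)) <
  (\int[mu]_(s in D) (k s * (H (k s) * f s))) * (\int[mu]_(s in D) f s).
Proof.
move=> f0 k0 kinj Hincr if_ ikf iHf ikHf.
set If := \int[mu]_(s in D) f s; set Ik := \int[mu]_(s in D) (k s * f s).
set IH := \int[mu]_(s in D) (H (k s) * f s).
set IkH := \int[mu]_(s in D) (k s * (H (k s) * f s)).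
have If0 : 0 < If by apply: (@Rintegral_gt0 _ 0) => // s s0; rewrite ?ltW// f0.
have Ik0 : 0 < Ik.
  by apply: (@Rintegral_gt0 _ 0) => // s s0; rewrite ?ltW// mulr_gt0 ?f0 ?k0.
pose m := Ik / If.
have m0 : 0 < m by rewrite divr_gt0.
pose phi s := (k s - m) * (H (k s) - H m) * f s.
have phiE s : phi s =
  k s * (H (k s) * f s) - m * (H (k s) * f s)
   - (H m * (k s * f s) - H m * m * f s) by rewrite /phi; ring.
have phi_gt0 s : 0 < s -> k s != m -> 0 < phi s.
  move=> s0; rewrite neq_lt => /orP[km|mk]; rewrite /phi pmulr_lgt0 ?f0//.
    by rewrite nmulr_rgt0 ?subr_lt0// Hincr// k0.
  by rewrite mulr_gt0 ?subr_gt0// Hincr.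
have iphi : mu.-integrable D (EFin \o phi).
  rewrite (funext phiE : phi = _).
  by do 2?apply: integrable_oyB => //; do 2?apply: integrable_oyZ.
have : 0 < \int[mu]_(s in D) phi s.
  (* injectivity of k leaves at most one point where phi vanishes *)
  have [[s0 [s00 ks0]]|nos0] := pselect (exists s, 0 < s /\ k s = m).
    apply: (@Rintegral_gt0 _ s0) => // s s0'.
      have [ks|] := eqVneq (k s) m; last by move/(phi_gt0 _ s0')/ltW.
      by rewrite /phi ks subrr !mul0r.
    move=> ss0; apply: phi_gt0 => //; apply: contra ss0 => /eqP ks.
    by apply/eqP/kinj => //; rewrite ks.
  have pos s : 0 < s -> 0 < phi s.
    by move=> s0; apply: phi_gt0 => //; apply/eqP => ks; apply: nos0; exists s.
  by apply: (@Rintegral_gt0 _ 0) => // s s0; rewrite ?ltW// pos.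
have -> : \int[mu]_(s in D) phi s = IkH - m * IH - (H m * Ik - H m * m * If).
  rewrite (funext phiE : phi = _).
  rewrite RintegralB ?RintegralB ?RintegralZl//;
    by [|do ?apply: integrable_oyB; do ?apply: integrable_oyZ].
rewrite (_ : H m * Ik - _ = 0); last first.
  by rewrite /m; field; rewrite gt_eqF.
rewrite subr0 subr_gt0 /m mulrAC ltr_pdivrMr//.
Qed.

End positivity.

(** * Integrability of the gamma weight *)

Section gamma_weight.
Context {R : realType}.
Notation mu := (@lebesgue_measure R).
Notation D := (`]0%R, +oo[%classic : set R).

Lemma is_derive_powRD (y p s : R) : 0 < y + s ->
  is_derive s 1 (fun s => (y + s) `^ p) (p * (y + s) `^ (p - 1)).
Proof.
move=> ys0.
have d1 : is_derive (y + s) 1 (@powR R ^~ p) (p * (y + s) `^ (p - 1)).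
  exact: is_derive1_powR.
have d2 : is_derive s 1 (fun s : R => y + s) 1.
  apply: (is_derive_eq (is_deriveD (is_derive_cst y s 1) (is_derive_id s 1))).
  by rewrite add0r.
apply: (is_derive_eq (@is_derive1_comp R (@powR R ^~ p) (fun s => y + s) s _ _ d1 d2)).
by rewrite mulr1.
Qed.

Lemma continuous_powRD (y p s : R) : 0 < y + s ->
  {for s, continuous (fun s => (y + s) `^ p)}.
Proof. by move=> ys0; exact: is_derive_continuous (is_derive_powRD _ ys0). Qed.

(** This is [u / p <= 1 + u / p <= e^{u / p}] raised to the power [p]. *)
Lemma powR_le_expR (p u : R) : 0 < p -> 0 < u -> u `^ p <= p `^ p * expR u.
Proof.
move=> p0 u0.
have up0 : 0 <= u / p by rewrite divr_ge0// ltW.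
rewrite -[X in X `^ p <= _](mulfVK (lt0r_neq0 p0)) mulrC powRM//; last exact: ltW.
rewrite ler_wpM2l ?powR_ge0//.
rewrite -[leRHS](_ : expR (u / p) `^ p = _); last first.
  by rewrite -expRM divfK ?lt0r_neq0.
rewrite ge0_ler_powR ?nnegrE ?expR_ge0//; first exact: ltW.
by rewrite (le_trans _ (expR_ge1Dx _))// lerDr.
Qed.

Lemma integrable_powRN2 :
  mu.-integrable D (EFin \o (fun v => (1 + v) `^ (- 2))).
Proof.
have pos (v : R) : 0 <= v -> 0 < 1 + v by move=> v0; rewrite ltr_pwDl.
have mpow : measurable_fun setT (fun v : R => (1 + v) `^ (- 2)).
  apply: (measurableT_comp (measurable_powR _)).
  exact: measurable_funD.
apply/integrableP; split; first exact/measurable_EFinP/measurable_funTS.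
under eq_integral do rewrite /= ger0_norm ?powR_ge0//.
rewrite integral_itv_obnd_cbnd; last first.
  exact/measurable_EFinP/measurable_funTS.
have dF (v : R) : 0 <= v ->
    is_derive v 1 (fun v => - (1 + v) `^ (- 1)) ((1 + v) `^ (- 2)).
  move=> v0; have := is_derive_powRD (-1) (pos _ v0).
  move=> /(@is_deriveN _ _ _ _ _ _ _) h; apply: (is_derive_eq h).
  by rewrite mulN1r opprK; congr (_ `^ _); lra.
rewrite (@ge0_continuous_FTC2y R _ (fun v => - (1 + v) `^ (- 1)) 0 0).
- by rewrite -EFinB ltry.
- by move=> x _; exact: powR_ge0.
- apply: continuous_in_subspaceT => v; rewrite inE/= in_itv/= andbT => v0.
  exact/continuous_powRD/pos.
- rewrite -oppr0; apply: cvgN.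
  have cv : (1 + v)^-1 @[v --> +oo] --> (0 : R).
    apply/(gtr0_cvgV0 (f := fun v : R => 1 + v)).
      by near=> v; rewrite pos//; near: v; exact: nbhs_pinfty_ge.
    apply/cvgryPge => A; near=> v; apply: (@le_trans _ _ v); last by rewrite lerDr.
    by near: v; apply: nbhs_pinfty_ge; exact: num_real.
  apply: cvg_trans cv; apply: near_eq_cvg; near=> v.
  rewrite powR_inv1//; apply/ltW/pos.
  by near: v; exact: nbhs_pinfty_ge.
- by move=> v /ltW/dF[].
- by apply: cvg_at_right_filter; exact: is_derive_continuous (dF 0 (lexx 0)).
- move=> v; rewrite in_itv/= andbT => v0; rewrite derive1E.
  by have [_ ->] := dF v (ltW v0).
Unshelve. all: end_near. Qed.

Lemma continuous_gamma_weight (q s : R) : 0 < s ->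
  {for s, continuous (fun s => expR (- s) * s `^ q)}.
Proof.
move=> s0; apply: continuousM.
  by apply: continuous_comp; [exact: continuousN|exact: continuous_expR].
exact: is_derive_continuous (is_derive1_powR q s0).
Qed.

(** The substitution [v = u^{q+1}] turns [(1 + v)^{-2} dv] into
    [(q + 1) u^q (1 + u^{q+1})^{-2} du], which is therefore integrable.  It has
    the right singularity at [0], and it dominates [e^{-u} u^q] up to a constant
    since [(1 + u^{q+1})^2 = O(e^u)]. *)
Lemma integrable_gamma_weight (q : R) : -1 < q ->
  mu.-integrable D (EFin \o (fun s => expR (- s) * s `^ q)).
Proof.
move=> q1.
have q10 : 0 < q + 1 by rewrite -ltrBlDr sub0r.
have D0 (s : R) : D s -> 0 < s by rewrite /= in_itv/= andbT.
pose f (u : R) := (1 + u `^ (q + 1)) `^ (- 2) * ((q + 1) * u `^ q).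
have f0 u : D u -> 0 <= f u by move=> _; rewrite !mulr_ge0 ?powR_ge0// ltW.
have [||||||||if_ _] := @Rsubstitution_oy R (@powR R ^~ (q + 1))
  (fun u => (q + 1) * u `^ q) (fun v => (1 + v) `^ (- 2)) 0 0.
- move=> t t0; apply: (is_derive_eq (is_derive1_powR (q + 1) t0)).
  by rewrite addrK.
- by move=> t t0; rewrite mulr_gt0 ?powR_gt0.
- move=> t t0; apply: continuousM; first exact: cst_continuous.
  exact: is_derive_continuous (is_derive1_powR q t0).
- by move=> t t0; exact: powR_gt0.
- move=> s s0; exists (s `^ (q + 1)^-1); first exact: powR_gt0.
  by rewrite -powRrM mulVf ?lt0r_neq0// powRr1// ltW.
- by move=> s s0; apply: continuous_powRD; rewrite addr_gt0.
- by move=> s _; exact: powR_ge0.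
- exact: integrable_powRN2.
(* 2 comes from (1 + w)^2 <= 2 (1 + w^2), the other factor from w^2 <= K e^u *)
pose C : R := 2 * (1 + (2 * (q + 1)) `^ (2 * (q + 1))) / (q + 1).
apply: (le_integrable _ _ _ (integrable_oyZ C if_)) => //.
  apply/measurable_EFinP/measurable_funTS; apply: measurable_funM.
    by apply: measurableT_comp => //; exact: measurableT_comp.
  exact: measurable_powR.
move=> u Du; have u0 := D0 _ Du.
rewrite /= lee_fin !ger0_norm; last 2 first.
- rewrite mulr_ge0 ?f0// divr_ge0 ?(ltW q10)//.
  by rewrite mulr_ge0// addr_ge0 ?powR_ge0.
- by rewrite mulr_ge0 ?expR_ge0 ?powR_ge0.
set w := u `^ (q + 1).
have w0 : 0 < w by exact: powR_gt0.
have w2 : w ^+ 2 <= (2 * (q + 1)) `^ (2 * (q + 1)) * expR u.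
  rewrite -powR_mulrn ?(ltW w0)// -powRrM [(q + 1) * _]mulrC.
  apply: powR_le_expR => //.
  by rewrite mulr_gt0.
have e1 : 1 <= expR u by rewrite -expR0 ler_expR ltW.
have K0 : 0 <= (2 * (q + 1)) `^ (2 * (q + 1)) by exact: powR_ge0.
have -> : C * f u =
    2 * (1 + (2 * (q + 1)) `^ (2 * (q + 1))) * (1 + w) ^- 2 * u `^ q.
  rewrite /C /f -/w powRN powR_mulrn; last by rewrite addr_ge0// ltW.
  by field; rewrite !lt0r_neq0// addr_gt0.
rewrite ler_wpM2r ?powR_ge0// expRN.
rewrite ler_pdivlMr; last by rewrite exprn_gt0// addr_gt0.
rewrite mulrC ler_pdivrMr ?expR_gt0//.
have : 0 <= (1 - w) ^+ 2 by exact: sqr_ge0.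
set K := _ `^ _ in w2 K0 *.
nra.
Qed.

End gamma_weight.

(** * The Stieltjes-type transform of the gamma weight *)

Section stieltjes.
Context {R : realType}.
Notation mu := (@lebesgue_measure R).
Notation D := (`]0%R, +oo[%classic : set R).
Implicit Types q p x y s : R.

Definition kern q p y s : R := expR (- s) * s `^ q * (y + s) `^ (- p).

(** A generalised Stieltjes transform: [(y + s)^{-p}] integrated against the
    unnormalised gamma density. *)
Definition stieltjes q p y : R := \int[mu]_(s in D) kern q p y s.

Lemma powRN_le p a b : 0 <= p -> 0 < a -> a <= b -> b `^ (- p) <= a `^ (- p).
Proof.
move=> p0 a0 ab; have b0 : 0 < b by exact: lt_le_trans ab.
rewrite !powRN lef_pV2 ?posrE ?powR_gt0// ge0_ler_powR// nnegrE ltW//.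
Qed.

Lemma powRN_lt p a b : 0 < p -> 0 < a -> a < b -> b `^ (- p) < a `^ (- p).
Proof.
move=> p0 a0 ab; have b0 : 0 < b by exact: lt_trans ab.
by rewrite !powRN ltf_pV2 ?posrE ?powR_gt0// gt0_ltr_powR// nnegrE ltW.
Qed.

Lemma kern_gt0 q p y s : 0 < y -> 0 < s -> 0 < kern q p y s.
Proof. by move=> y0 s0; rewrite !mulr_gt0 ?expR_gt0 ?powR_gt0// addr_gt0. Qed.

Lemma kern_ge0 q p y s : 0 <= kern q p y s.
Proof. by rewrite !mulr_ge0 ?expR_ge0 ?powR_ge0. Qed.

Lemma kernS q p y s : 0 < y + s ->
  kern q (p + 1) y s = (y + s)^-1 * kern q p y s.
Proof.
move=> ys0; rewrite /kern opprD powRD; last by rewrite (gt_eqF ys0) implybT.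
by rewrite powR_inv1 ?ltW//; ring.
Qed.

Lemma measurable_kern q p y (A : set R) : measurable_fun A (kern q p y).
Proof.
apply: measurable_funTS; apply: measurable_funM.
  apply: measurable_funM; last exact: measurable_powR.
  by apply: measurableT_comp => //; exact: measurableT_comp.
by apply: (measurableT_comp (measurable_powR _)); exact: measurable_funD.
Qed.

Lemma kern_le q p y s : 0 <= p -> 0 < y -> 0 < s ->
  kern q p y s <= y `^ (- p) * (expR (- s) * s `^ q).
Proof.
move=> p0 y0 s0; rewrite mulrC ler_wpM2l ?mulr_ge0 ?expR_ge0 ?powR_ge0//.
by apply: powRN_le => //; rewrite lerDl ltW.
Qed.

Lemma integrable_kern q p y : -1 < q -> 0 <= p -> 0 < y ->
  mu.-integrable D (EFin \o kern q p y).
Proof.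
move=> q1 p0 y0.
apply: (le_integrable _ _ _
  (integrable_oyZ (y `^ (- p)) (integrable_gamma_weight q1))) => //.
  by apply/measurable_EFinP; exact: measurable_kern.
move=> s; rewrite /= in_itv/= andbT => s0.
rewrite lee_fin !ger0_norm ?kern_ge0 ?mulr_ge0 ?expR_ge0 ?powR_ge0//.
exact: kern_le.
Qed.

Lemma continuous_kern q p y s : 0 <= y -> 0 < s ->
  {for s, continuous (kern q p y)}.
Proof.
move=> y0 s0; apply: continuousM; first exact: continuous_gamma_weight.
by apply: continuous_powRD; rewrite ltr_wpDl.
Qed.

Lemma stieltjes_gt0 q p y : -1 < q -> 0 <= p -> 0 < y -> 0 < stieltjes q p y.
Proof.
move=> q1 p0 y0; apply: (@Rintegral_gt0 _ _ 0); first exact: integrable_kern.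
  by move=> s _; exact: kern_ge0.
by move=> s s0 _; exact: kern_gt0.
Qed.

Lemma is_derive_kern q p y s : 0 < y + s ->
  is_derive y 1 (kern q p ^~ s) (- p * kern q (p + 1) y s).
Proof.
move=> ys0; rewrite addrC in ys0.
have d := is_derive_powRD (- p) ys0.
have -> : kern q p ^~ s = (expR (- s) * s `^ q) *: (fun y => (s + y) `^ (- p)).
  by apply/funext => z; rewrite /kern addrC.
apply: (is_derive_eq (is_deriveZ (expR (- s) * s `^ q) d)).
by rewrite /kern opprD (addrC y) /GRing.scale/=; ring.
Qed.

(** Differentiation under the integral sign: for [x > y / 2] the derivative of
    the kernel is dominated by [p (y / 2)^{-p-1}] times the gamma weight. *)
Lemma is_derive_stieltjes q p y : -1 < q -> 0 <= p -> 0 < y ->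
  is_derive y 1 (stieltjes q p) (- p * stieltjes q (p + 1) y).
Proof.
move=> q1 p0 y0.
have D0 s : D s -> 0 < s by rewrite /= in_itv/= andbT.
have h0 : 0 < y / 2 by rewrite divr_gt0.
pose G s := p * ((y / 2) `^ (- (p + 1)) * (expR (- s) * s `^ q)).
have Iy : `]y / 2, y * 2[%classic y.
  by rewrite /= in_itv/=; apply/andP; split; lra.
have I0 x : `]y / 2, y * 2[%classic x -> 0 < x /\ y / 2 <= x.
  by rewrite /= in_itv/= => /andP[yx _]; split; [exact: lt_trans yx|exact: ltW].
have ik x : `]y / 2, y * 2[%classic x -> mu.-integrable D (EFin \o kern q p x).
  by move=> /I0[x0 _]; exact: integrable_kern.
have dk x s : `]y / 2, y * 2[%classic x -> D s ->
    is_derive x 1 (kern q p ^~ s) (- p * kern q (p + 1) x s).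
  by move=> /I0[x0 _] /D0 s0; apply: is_derive_kern; rewrite addr_gt0.
have derk x s : `]y / 2, y * 2[%classic x -> D s -> derivable (kern q p ^~ s) x 1.
  by move=> Ix Ds; have [] := dk x s Ix Ds.
have pE x s : `]y / 2, y * 2[%classic x -> D s ->
    partial1of2 (kern q p) x s = - p * kern q (p + 1) x s.
  by move=> Ix Ds; rewrite partial1of2E; have [_ ->] := dk x s Ix Ds.
have G0 s : 0 <= G s by rewrite !mulr_ge0 ?expR_ge0 ?powR_ge0.
have iG : mu.-integrable D (EFin \o G).
  by do 2!apply: integrable_oyZ; exact: integrable_gamma_weight.
have Gub x s : `]y / 2, y * 2[%classic x -> D s ->
    `|partial1of2 (kern q p) x s| <= G s.
  move=> Ix Ds; rewrite pE// normrM normrN !ger0_norm ?kern_ge0//.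
  have [x0 yx] := I0 _ Ix; have s0 := D0 _ Ds.
  rewrite ler_wpM2l// (le_trans (kern_le _ _ _ _))//; first exact: addr_ge0.
  rewrite ler_wpM2r ?mulr_ge0 ?expR_ge0 ?powR_ge0// powRN_le//.
  exact: addr_ge0.
apply: DeriveDef.
  by apply: (@derivable_under_integral R _ _ mu (kern q p) D _ y _ _ Iy _ _ G).
rewrite -derive1E.
rewrite (@differentiation_under_integral R _ _ mu (kern q p) D _ y _ _ Iy _ _ G)//.
rewrite /stieltjes -RintegralZl//; last by apply: integrable_kern => //; exact: addr_ge0.
by apply: eq_Rintegral => s; rewrite inE => Ds; rewrite pE.
Qed.

End stieltjes.

(** * Monotonicity of the transforms and of their quotients *)

Section monotonicity.
Context {R : realType}.
Notation mu := (@lebesgue_measure R).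
Notation D := (`]0%R, +oo[%classic : set R).
Implicit Types q p x y s : R.

Lemma eq_integrable_oy (f g : R -> R) : (forall s, 0 < s -> f s = g s) ->
  mu.-integrable D (EFin \o f) -> mu.-integrable D (EFin \o g).
Proof.
move=> fg; apply: eq_integrable => // s.
by rewrite inE/= in_itv/= andbT => s0; rewrite fg.
Qed.

Lemma eq_Rintegral_oy (f g : R -> R) : (forall s, 0 < s -> f s = g s) ->
  \int[mu]_(s in D) f s = \int[mu]_(s in D) g s.
Proof.
by move=> fg; apply: eq_Rintegral => s; rewrite inE/= in_itv/= andbT => /fg.
Qed.

Lemma stieltjes_decreasing q p y1 y2 : -1 < q -> 0 < p -> 0 < y1 -> y1 < y2 ->
  stieltjes q p y2 < stieltjes q p y1.
Proof.
move=> q1 p0 y10 y12; have y20 : 0 < y2 by exact: lt_trans y12.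
apply: Rintegral_lt; [exact: (integrable_kern q1 (ltW p0))..|].
move=> s s0; rewrite ltr_pM2l ?mulr_gt0 ?expR_gt0 ?powR_gt0//.
by apply: powRN_lt => //; rewrite ?addr_gt0// ltrD2r.
Qed.

(** The factor [y^p] turns [(y + s)^{-p}] into [(1 + s / y)^{-p}], which
    increases with [y]. *)
Lemma powR_stieltjes_increasing q p y1 y2 :
  -1 < q -> 0 < p -> 0 < y1 -> y1 < y2 ->
  y1 `^ p * stieltjes q p y1 < y2 `^ p * stieltjes q p y2.
Proof.
move=> q1 p0 y10 y12; have y20 : 0 < y2 by exact: lt_trans y12.
have ik y : 0 < y -> mu.-integrable D (EFin \o kern q p y).
  by move=> y0; exact: (integrable_kern q1 (ltW p0)).
rewrite /stieltjes -!RintegralZl//; try exact: ik.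
apply: Rintegral_lt; [exact/integrable_oyZ/ik..|].
move=> s s0.
have E y : 0 < y -> y `^ p * kern q p y s =
    expR (- s) * s `^ q * (1 + s / y) `^ (- p).
  move=> y0; rewrite /kern (_ : 1 + s / y = (y + s) / y); last first.
    by field; rewrite gt_eqF.
  rewrite powRM ?invr_ge0 ?(ltW y0) ?addr_ge0 ?(ltW s0) ?(ltW y0)//.
  by rewrite -powR_inv1 ?(ltW y0)// -powRrM mulN1r opprK; ring.
rewrite !E// ltr_pM2l ?mulr_gt0 ?expR_gt0 ?powR_gt0//.
apply: powRN_lt => //; first by rewrite addr_gt0// divr_gt0.
by rewrite ltrD2l ltr_pM2l// ltf_pV2.
Qed.

(** Take [f = w(s) (y2 + s)^{-p}] and [k = 1 / (y1 + s)].  Going from the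
    density at [y2] to the one at [y1] is multiplication by
    [((y2 + s) / (y1 + s))^p = (1 + (y2 - y1) k)^p], so the mean of [k] is
    smaller at [y2] than at [y1]; and at [y2] the function to average is
    [1 / (y2 + s)], smaller than [k]. *)
Lemma stieltjes_ratio_decreasing q p y1 y2 :
  -1 < q -> 0 < p -> 0 < y1 -> y1 < y2 ->
  stieltjes q (p + 1) y2 / stieltjes q p y2 <
  stieltjes q (p + 1) y1 / stieltjes q p y1.
Proof.
move=> q1 p0 y10 y12; have y20 : 0 < y2 by exact: lt_trans y12.
have p1 : 0 <= p + 1 by rewrite addr_ge0// ltW.
pose k s := (y1 + s)^-1.
pose H x := (1 + (y2 - y1) * x) `^ p.
have y1s s : 0 < s -> 0 < y1 + s by move=> s0; rewrite addr_gt0.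
have y2s s : 0 < s -> 0 < y2 + s by move=> s0; rewrite addr_gt0.
have HE s : 0 < s -> H (k s) * kern q p y2 s = kern q p y1 s.
  move=> s0; rewrite /H (_ : _ + _ = (y2 + s) / (y1 + s)); last first.
    by rewrite /k; field; rewrite gt_eqF ?y1s.
  rewrite powRM ?invr_ge0 ?(ltW (y1s _ s0)) ?(ltW (y2s _ s0))//.
  rewrite -powR_inv1 ?(ltW (y1s _ s0))// -powRrM mulN1r.
  rewrite mulrC /kern mulrA -(mulrA (expR _ * _)) (powRN (y2 + s)) mulVf ?mulr1//.
  by rewrite gt_eqF// powR_gt0// y2s.
have kE s : 0 < s -> k s * (H (k s) * kern q p y2 s) = kern q (p + 1) y1 s.
  by move=> s0; rewrite HE// /k -kernS ?y1s.
have D0 s : s \in D -> 0 < s by rewrite inE/= in_itv/= andbT.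
have iH : mu.-integrable D (EFin \o (fun s => H (k s) * kern q p y2 s)).
  apply: (@eq_integrable_oy (kern q p y1)) => [s s0|]; first by rewrite HE.
  exact: integrable_kern q1 (ltW p0) y10.
have ikH : mu.-integrable D (EFin \o (fun s => k s * (H (k s) * kern q p y2 s))).
  apply: (@eq_integrable_oy (kern q (p + 1) y1)) => [s s0|]; first by rewrite kE.
  exact: integrable_kern.
have if_ := integrable_kern q1 (ltW p0) y20.
have ik : mu.-integrable D (EFin \o (fun s => k s * kern q p y2 s)).
  apply: (le_integrable _ _ _ (integrable_oyZ y1^-1 if_)) => //.
    apply/measurable_EFinP/measurable_funM; last exact: measurable_kern.
    apply: open_continuous_measurable_fun => //.
    move=> s /D0 s0; apply: continuousV; first by rewrite gt_eqF// y1s.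
    by apply: continuousD; [exact: cst_continuous|exact: cvg_id].
  move=> s /mem_set/D0 s0; rewrite lee_fin /= !normrM ler_wpM2r// /k.
  rewrite !ger0_norm ?invr_ge0 ?(ltW y10) ?(ltW (y1s _ s0))//.
  by rewrite lef_pV2 ?posrE ?y1s// lerDl ltW.
have kpos s : 0 < s -> 0 < kern q p y2 s by exact: kern_gt0.
have cheb := @integral_chebyshev R (kern q p y2) k H kpos.
have {}cheb : (\int[mu]_(s in D) (k s * kern q p y2 s)) * stieltjes q p y1 <
    stieltjes q (p + 1) y1 * stieltjes q p y2.
  rewrite /stieltjes -(eq_Rintegral_oy HE).
  rewrite -(eq_Rintegral_oy kE).
  apply: cheb => //.
  - by move=> s s0; rewrite invr_gt0 y1s.
  - by move=> s t s0 t0 /invr_inj /addrI.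
  - move=> x y x0 xy; apply: gt0_ltr_powR => //.
    + by rewrite nnegrE addr_ge0// mulr_ge0 ?(ltW x0)// subr_ge0 ltW.
    + by rewrite nnegrE addr_ge0// mulr_ge0 ?subr_ge0 ?ltW// (lt_trans x0).
    + by rewrite ltrD2l ltr_pM2l// subr_gt0.
rewrite ltr_pdivrMr ?stieltjes_gt0 ?(ltW p0)// mulrAC.
rewrite ltr_pdivlMr ?stieltjes_gt0 ?(ltW p0)//.
apply: le_lt_trans cheb.
rewrite ler_wpM2r ?(ltW (stieltjes_gt0 q1 (ltW p0) y10))//.
apply: le_Rintegral => //; first exact: integrable_kern.
move=> s /mem_set/D0 s0; rewrite kernS ?y2s//.
rewrite ler_wpM2r ?kern_ge0// lef_pV2 ?posrE ?y1s ?y2s//.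
by rewrite lerD2r ltW.
Qed.

Lemma integral_scale_oy (G : R -> R) y : 0 < y ->
  (forall s, 0 < s -> {for s, continuous G}) ->
  (forall s, 0 < s -> 0 <= G s) ->
  mu.-integrable D (EFin \o G) ->
  mu.-integrable D (EFin \o (fun u => G (y * u))) /\
  \int[mu]_(u in D) G (y * u) = y^-1 * \int[mu]_(s in D) G s.
Proof.
move=> y0 cG G0 iG.
have [||||||||i e] := @Rsubstitution_oy R (fun u => y * u) (cst y) G 0 0.
- move=> t _; apply: (is_derive_eq (is_deriveZ y (is_derive_id t 1))).
  by rewrite /GRing.scale/= mulr1.
- by [].
- by move=> t _; exact: cst_continuous.
- by move=> t t0; rewrite mulr_gt0.
- move=> s s0; exists (s / y); first by rewrite divr_gt0.
  by rewrite mulrC divfK// gt_eqF.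
- exact: cG.
- exact: G0.
- exact: iG.
have cancel_y u : G (y * u) = y^-1 * (G (y * u) * y).
  by rewrite mulrCA mulVf ?mulr1// gt_eqF.
have iGu : mu.-integrable D (EFin \o (fun u => G (y * u))).
  by rewrite (funext cancel_y); exact: integrable_oyZ.
split => //; rewrite e -RintegralZl//.
by apply: eq_Rintegral => u _; exact: cancel_y.
Qed.

(** After the scaling [s = y u] the quotient is the mean of [k = 1 / (1 + u)]
    for the density [f p y].  Since [u = 1 / k - 1], the density ratio
    [e^{- (y2 - y1) u}] is the increasing function [H] of [k]. *)
Lemma mul_stieltjes_ratio_increasing q p y1 y2 :
  -1 < q -> 0 < p -> 0 < y1 -> y1 < y2 ->
  y1 * stieltjes q (p + 1) y1 / stieltjes q p y1 <
  y2 * stieltjes q (p + 1) y2 / stieltjes q p y2.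
Proof.
move=> q1 p0 y10 y12; have y20 : 0 < y2 by exact: lt_trans y12.
have p1 : 0 <= p + 1 by rewrite addr_ge0// ltW.
pose f (r y u : R) := u `^ q * (1 + u) `^ (- r) * expR (- (y * u)).
pose k (u : R) := (1 + u)^-1.
pose H x := expR (- ((y2 - y1) * (x^-1 - 1))).
have u1 (u : R) : 0 < u -> 0 < 1 + u by move=> u0; rewrite addr_gt0.
have HE r u : H (k u) * f r y1 u = f r y2 u.
  rewrite /H /k invrK /f mulrCA -expRD; congr (_ * expR _); ring.
have kE r y u : 0 < u -> k u * f r y u = f (r + 1) y u.
  move=> u0; rewrite /f /k opprD powRD; last first.
    by rewrite (gt_eqF (u1 _ u0)) implybT.
  by rewrite powR_inv1 ?(ltW (u1 _ u0))//; ring.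
have fE r y u : 0 < y -> 0 < u -> f r y u = y `^ (r - q) * kern q r y (y * u).
  move=> y0 u0; rewrite /kern (_ : y + y * u = y * (1 + u)); last by ring.
  rewrite !powRM ?(ltW y0) ?(ltW u0) ?(ltW (u1 _ u0))//.
  rewrite powRD; last by rewrite (gt_eqF y0) implybT.
  rewrite /f !powRN; field.
  by rewrite !gt_eqF// powR_gt0// u1.
have D0 s : s \in D -> 0 < s by rewrite inE/= in_itv/= andbT.
have intf r y : 0 <= r -> 0 < y -> mu.-integrable D (EFin \o f r y) /\
    \int[mu]_(u in D) f r y u = y `^ (r - q) * (y^-1 * stieltjes q r y).
  move=> r0 y0.
  have [||i e] := @integral_scale_oy (kern q r y) y y0 _ _ (integrable_kern q1 r0 y0).
  - by move=> s s0; apply: continuous_kern => //; exact: ltW.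
  - by move=> s _; exact: kern_ge0.
  split.
    by apply: eq_integrable_oy (integrable_oyZ (y `^ (r - q)) i) => u u0; rewrite fE.
  rewrite -e -RintegralZl//; apply: eq_Rintegral => u /D0 u0; exact: fE.
have [i1 e1] := intf p y1 (ltW p0) y10.
have [i2 e2] := intf p y2 (ltW p0) y20.
have [i3 e3] := intf (p + 1) y1 p1 y10.
have [i4 e4] := intf (p + 1) y2 p1 y20.
have kE2 u : 0 < u -> k u * (H (k u) * f p y1 u) = f (p + 1) y2 u.
  by move=> u0; rewrite HE kE.
have : (\int[mu]_(u in D) f (p + 1) y1 u) * (\int[mu]_(u in D) f p y2 u) <
  (\int[mu]_(u in D) f (p + 1) y2 u) * (\int[mu]_(u in D) f p y1 u).
  rewrite -(eq_Rintegral_oy (kE p y1)).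
  rewrite -(eq_Rintegral_oy kE2).
  rewrite -(eq_Rintegral_oy (fun u _ => HE p u)).
  apply: integral_chebyshev => //.
  - by move=> u u0; rewrite !mulr_gt0 ?powR_gt0 ?expR_gt0 ?u1.
  - by move=> u u0; rewrite invr_gt0 u1.
  - by move=> s t s0 t0 /invr_inj /addrI.
  - move=> x y x0 xy; rewrite ltr_expR ltrN2 ltr_pM2l ?subr_gt0//.
    by rewrite ltrD2r ltf_pV2 ?posrE// (lt_trans x0).
  - by apply: eq_integrable_oy i3 => u u0; rewrite kE.
  - by apply: eq_integrable_oy i2 => u _; rewrite HE.
  - by apply: eq_integrable_oy i4 => u u0; rewrite kE2.
rewrite e1 e2 e3 e4 => ineq.
have pB y : 0 < y -> y `^ (p + 1 - q) = y * y `^ (p - q).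
  move=> y0; rewrite (_ : p + 1 - q = 1 + (p - q)); last by ring.
  rewrite (powRD (r := 1)); last by rewrite (gt_eqF y0) implybT.
  by rewrite powRr1 ?(ltW y0).
rewrite !pB// in ineq.
rewrite ltr_pdivrMr ?stieltjes_gt0 ?(ltW p0)// mulrAC.
rewrite ltr_pdivlMr ?stieltjes_gt0 ?(ltW p0)//.
pose c := y1 `^ (p - q) * y2 `^ (p - q) / (y1 * y2).
have c0 : 0 < c by rewrite divr_gt0 ?mulr_gt0 ?powR_gt0.
rewrite -(ltr_pM2l c0).
apply: etrans ineq; congr (_ < _); rewrite /c; field; rewrite !gt_eqF//.
Qed.

End monotonicity.

(** * Expression of the function and of its derivative *)

Section Vq_stieltjes.
Context {R : realType}.
Notation mu := (@lebesgue_measure R).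
Notation D := (`]0%R, +oo[%classic : set R).
Implicit Types q x : R.

Lemma Gamma_gt0 q : -1 < q -> 0 < Gamma (q + 1).
Proof.
move=> q1; rewrite /Gamma.
under eq_Rintegral do rewrite addrK mulrC.
apply: (@Rintegral_gt0 _ _ 0); first exact: integrable_gamma_weight.
  by move=> s _; rewrite mulr_ge0 ?expR_ge0 ?powR_ge0.
by move=> s s0 _; rewrite mulr_gt0 ?expR_gt0 ?powR_gt0.
Qed.

(** The substitution [s = t ^+ 2 - x ^+ 2], for which [x ^+ 2 + s = t ^+ 2] and
    [ds = 2 t dt], so that the factor [(x ^+ 2 + s)^{-1/2}] cancels [t]. *)
Lemma Vq_stieltjes q x : -1 < q -> 0 < x ->
  Vq q x = (Gamma (q + 1))^-1 * stieltjes q 2^-1 (x ^+ 2).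
Proof.
move=> q1 x0; have x20 : 0 < x ^+ 2 by rewrite exprn_gt0.
have h0 : 0 <= 2^-1 :> R by rewrite invr_ge0.
have [||||||||i e] := @Rsubstitution_oy R (fun t => t ^+ 2 - x ^+ 2)
  (fun t => 2 * t) (kern q 2^-1 (x ^+ 2)) x 0.
- move=> t _.
  apply: (is_derive_eq (is_deriveB (is_deriveX 2 (is_derive_id t 1))
    (is_derive_cst (x ^+ 2) t 1))).
  by rewrite subr0 /GRing.scale/= expr1 mulr1 mulr_natl.
- by move=> t xt; rewrite mulr_gt0// (lt_trans x0).
- by move=> t _; apply: continuousM; [exact: cst_continuous|exact: cvg_id].
- by move=> t xt; rewrite subr_gt0 ltr_pXn2r ?nnegrE// ltW// (lt_trans x0).
- move=> s s0; exists (Num.sqrt (s + x ^+ 2)).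
    rewrite -[ltLHS]gtr0_norm// -sqrtr_sqr ltr_sqrt ?addr_gt0//.
    by rewrite ltrDr.
  by rewrite sqr_sqrtr ?addrK// addr_ge0// ltW.
- by move=> s s0; apply: continuous_kern => //; exact: ltW.
- by move=> s _; exact: kern_ge0.
- exact: integrable_kern.
pose c := 2 * expR (x ^+ 2).
have c0 : c != 0 by rewrite mulf_neq0// gt_eqF// expR_gt0.
have V : \int[mu]_(t in `]x, +oo[) (expR (- t ^+ 2) * (t ^+ 2 - x ^+ 2) `^ q)
    = c^-1 * stieltjes q 2^-1 (x ^+ 2).
  rewrite /stieltjes e -RintegralZl//.
  apply: eq_Rintegral => t; rewrite inE/= in_itv/= andbT => xt.
  have t0 : 0 < t by exact: lt_trans xt.
  rewrite /kern (addrC (x ^+ 2)) subrK powRN powR12_sqrt ?sqr_ge0// sqrtr_sqr gtr0_norm//.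
  rewrite opprB expRD /c; field.
  by rewrite !gt_eqF// expR_gt0.
rewrite /Vq V -/c; field.
by rewrite c0 gt_eqF// Gamma_gt0.
Qed.

Lemma is_derive_Vq q x : -1 < q -> 0 < x ->
  is_derive x 1 (Vq q) (- (Gamma (q + 1))^-1 * x * stieltjes q (2^-1 + 1) (x ^+ 2)).
Proof.
move=> q1 x0; have x20 : 0 < x ^+ 2 by rewrite exprn_gt0.
have h0 : 0 <= 2^-1 :> R by rewrite invr_ge0.
apply: (@near_eq_is_derive _ _ _
    ((Gamma (q + 1))^-1 *: (stieltjes q 2^-1 \o (fun z : R => z ^+ 2)))).
  near=> z; rewrite Vq_stieltjes//.
  by near: z; exact: lt_nbhsr.
have d2 : is_derive x 1 (fun z : R => z ^+ 2) (2 * x).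
  apply: (is_derive_eq (is_deriveX 2 (is_derive_id x 1))).
  by rewrite /GRing.scale/= expr1 mulr1 mulr_natl.
have d := @is_derive1_comp R _ (fun z : R => z ^+ 2) x _ _
  (is_derive_stieltjes q1 h0 x20) d2.
apply: (is_derive_eq (is_deriveZ _ d)).
rewrite /GRing.scale/=; field.
by rewrite gt_eqF// Gamma_gt0.
Unshelve. all: end_near. Qed.

Lemma derive1_Vq q x : -1 < q -> 0 < x ->
  derive1 (Vq q) x = - (Gamma (q + 1))^-1 * x * stieltjes q (2^-1 + 1) (x ^+ 2).
Proof. by move=> q1 x0; rewrite derive1E; have [_ ->] := is_derive_Vq q1 x0. Qed.

End Vq_stieltjes.

(** * The four monotonicity statements *)

Section square_substitution.
Context {R : realType}.

(** Each function of [x] in the theorem is the opposite of a function of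
    [y = x ^+ 2]. *)
Lemma strictly_decreasing_pos_opp_sqr (f g : R -> R) :
  (forall x, 0 < x -> f x = - g (x ^+ 2)) ->
  (forall y1 y2, 0 < y1 -> y1 < y2 -> g y1 < g y2) ->
  strictly_decreasing_pos f.
Proof.
move=> fE gincr x y; rewrite !in_itv/= !andbT => x0 y0 xy.
rewrite !fE// ltrN2; apply: gincr; first exact: exprn_gt0.
by rewrite ltr_pXn2r ?nnegrE// ltW.
Qed.

Lemma strictly_increasing_pos_opp_sqr (f g : R -> R) :
  (forall x, 0 < x -> f x = - g (x ^+ 2)) ->
  (forall y1 y2, 0 < y1 -> y1 < y2 -> g y2 < g y1) ->
  strictly_increasing_pos f.
Proof.
move=> fE gdecr x y; rewrite !in_itv/= !andbT => x0 y0 xy.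
rewrite !fE// ltrN2; apply: gdecr; first exact: exprn_gt0.
by rewrite ltr_pXn2r ?nnegrE// ltW.
Qed.

End square_substitution.

Unset Implicit Arguments.

Theorem theorem1 (R : realType) :
  [/\ (forall q : R, -1 < q ->
         strictly_decreasing_pos (fun x : R => x * derive1 (Vq q) x / Vq q x)),
      (forall q : R, -1 < q ->
         strictly_decreasing_pos (fun x : R => x ^+ 2 * derive1 (Vq q) x)),
      (forall q : R, 0 <= q ->
         strictly_increasing_pos (fun x : R => x^-1 * derive1 (Vq q) x)) &
      (forall q : R, 0 <= q ->
         strictly_increasing_pos
           (fun x : R => derive1 (Vq q) x / (x * Vq q x)))].
Proof.
have h0 : 0 < 2^-1 :> R by rewrite invr_gt0.
have h1 : 0 < 2^-1 + 1 :> R by exact: addr_gt0.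
have m1 (q : R) : 0 <= q -> -1 < q.
  by move=> q0; rewrite (lt_le_trans _ q0)// oppr_lt0.
have Gamma_neq0 (q : R) : -1 < q -> Gamma (q + 1) != 0.
  by move=> q1; rewrite gt_eqF// Gamma_gt0.
have I0 (q x : R) : -1 < q -> 0 < x -> stieltjes q 2^-1 (x ^+ 2) != 0.
  by move=> q1 x0; rewrite gt_eqF// stieltjes_gt0// ?exprn_gt0// ltW.
split=> q hq.
- apply: (@strictly_decreasing_pos_opp_sqr _ _
    (fun y => y * stieltjes q (2^-1 + 1) y / stieltjes q 2^-1 y)).
    move=> x x0; rewrite derive1_Vq// Vq_stieltjes//.
    by field; rewrite I0//= Gamma_neq0.
  by move=> y1 y2 y10 y12; exact: mul_stieltjes_ratio_increasing.
- apply: (@strictly_decreasing_pos_opp_sqr _ _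
    (fun y => (Gamma (q + 1))^-1 *
      (y `^ (2^-1 + 1) * stieltjes q (2^-1 + 1) y))).
    move=> x x0; rewrite derive1_Vq// powRD; last first.
      by rewrite (gt_eqF (exprn_gt0 2 x0)) implybT.
    rewrite powR12_sqrt ?sqr_ge0// sqrtr_sqr gtr0_norm// powRr1 ?sqr_ge0//.
    by ring.
  move=> y1 y2 y10 y12; rewrite ltr_pM2l ?invr_gt0 ?Gamma_gt0//.
  exact: powR_stieltjes_increasing.
- have q1 := m1 q hq.
  apply: (@strictly_increasing_pos_opp_sqr _ _
    (fun y => (Gamma (q + 1))^-1 * stieltjes q (2^-1 + 1) y)).
    move=> x x0; rewrite derive1_Vq//.
    by field; rewrite Gamma_neq0//= gt_eqF.
  move=> y1 y2 y10 y12; rewrite ltr_pM2l ?invr_gt0 ?Gamma_gt0//.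
  exact: stieltjes_decreasing.
- have q1 := m1 q hq.
  apply: (@strictly_increasing_pos_opp_sqr _ _
    (fun y => stieltjes q (2^-1 + 1) y / stieltjes q 2^-1 y)).
    move=> x x0; rewrite derive1_Vq// Vq_stieltjes//.
    by field; rewrite I0//= Gamma_neq0//= gt_eqF.
  by move=> y1 y2 y10 y12; exact: stieltjes_ratio_decreasing.
Qed.
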